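(* For every $P\in\mathcal P({}^2\mathbb R^2)$, $$\max_{(x,y)\in\mathfrak O}\|\nabla P(x,y)\|_2\le 2\sqrt5\,\|P\|_{\mathfrak O}.$$ The constant is optimal, so $\mathfrak M_{\mathfrak O}=2\sqrt5$. Equality is attained at the points $(1,0)$ and $(0,1)$ by $P_*(x,y)=-x^2+4xy-y^2$ and by $-P_*$; that is, $\|\nabla P(1,0)\|_2=\|\nabla P(0,1)\|_2=2\sqrt5\,\|P\|_{\mathfrak O}$ for $P=\pm P_*$.
   Context: $\mathfrak O:=\{(x,y)\in[0,1]^2: x+y\le\sqrt2\}$. $\mathcal P({}^2\mathbb R^2)$ is the real vector space of quadratic forms $P(x,y)=ax^2+bxy+cy^2$ with $a,b,c\in\mathbb R$, normed by $\|P\|_{\mathfrak O}:=\sup_{(x,y)\in\mathfrak O}|P(x,y)|$. $\nabla P=(\partial P/\partial x,\partial P/\partial y)$ and $\|\cdot\|_2$ is the Euclidean norm on $\mathbb R^2$. Put $$\mathfrak B_{\mathfrak O}(x,y):=\sup\{\|\nabla P(x,y)\|_2: P\in\mathcal P({}^2\mathbb R^2),\ \|P\|_{\mathfrak O}\le1\},\qquad \mathfrak M_{\mathfrak O}:=\max_{(x,y)\in\mathfrak O}\mathfrak B_{\mathfrak O}(x,y).$$ *)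

(* Defs.v *)
From HB Require Import structures.
From mathcomp Require Import all_boot all_order all_algebra.
From mathcomp Require Import all_classical all_reals all_analysis.
Set Implicit Arguments.
Unset Strict Implicit.
Unset Printing Implicit Defensive.
Import Order.TTheory GRing.Theory Num.Theory.
Import numFieldNormedType.Exports.
Local Open Scope classical_set_scope.
Local Open Scope ring_scope.

Definition octagonO (R : realType) : set (R * R) :=
  [set z | [/\ 0 <= z.1 <= 1, 0 <= z.2 <= 1 & z.1 + z.2 <= Num.sqrt 2]].

Definition quadratic_forms (R : realType) : set (R * R -> R) :=
  [set P | exists a b c : R,
    P = fun z => a * z.1 ^+ 2 + b * (z.1 * z.2) + c * z.2 ^+ 2].

Arguments octagonO R _ : clear implicits.
Arguments quadratic_forms R _ : clear implicits.

(* [sup] returns the default value 0 on sets without a supremum; the sets below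
   are nonempty and bounded as soon as P is a quadratic form. *)
Definition normO (R : realType) (P : R * R -> R) : R :=
  sup [set `|P z| | z in octagonO R].

Definition gradient (R : realType) (P : R * R -> R) (z : R * R) : R * R :=
  (derive1 (fun x : R => P (x, z.2)) z.1, derive1 (fun y : R => P (z.1, y)) z.2).

(* The library norm on R * R is the maximum norm, hence this definition. *)
Definition norm2 (R : realType) (v : R * R) : R :=
  Num.sqrt (v.1 ^+ 2 + v.2 ^+ 2).

(* Again a supremum of a nonempty bounded set: normO is a norm on a
   finite-dimensional space, on which P |-> gradient P z is linear. *)
Definition bernsteinO (R : realType) (z : R * R) : R :=
  sup [set norm2 (gradient P z) | P in
        [set P | quadratic_forms R P /\ normO P <= 1]].

Definition is_max (R : realType) (A : set R) (m : R) : Prop :=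
  A m /\ ubound A m.

(* The extremal Markov constant, characterized as an attained maximum. *)
Definition is_markovO (R : realType) (M : R) : Prop :=
  is_max [set bernsteinO z | z in octagonO R] M.

Definition Pstar (R : realType) (z : R * R) : R :=
  - z.1 ^+ 2 + 4 * (z.1 * z.2) - z.2 ^+ 2.

(* Main.v *)
(* Write P = a x^2 + b xy + c y^2 and N = normO P.  The values of P at (1,0),
   (0,1) and (1/sqrt 2, 1/sqrt 2) give |a| <= N, |c| <= N and |a+b+c| <= 2N,
   hence |b| <= 4N.  The squared gradient F is a quadratic form with
   F(1,0) = 4a^2+b^2 <= 20N^2, F(0,1) = b^2+4c^2 <= 20N^2 and
   F(1,1) = 2(a+b+c)^2 + 2(a-c)^2 <= 16N^2; as
   F(x,y) = F(1,0) x(x-y) + F(0,1) y(y-x) + F(1,1) xy,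
   one gets F <= 20N^2 on the whole unit square. *)
Require Import Defs.
From HB Require Import structures.
From mathcomp Require Import all_boot all_order all_algebra.
From mathcomp Require Import all_classical all_reals all_analysis.
From mathcomp Require Import ring lra.
Import Order.TTheory GRing.Theory Num.Theory.
Import numFieldNormedType.Exports.
Local Open Scope classical_set_scope.
Local Open Scope ring_scope.

(** The body is convertible with the one inside [quadratic_forms], so passing between the two needs
    no argument. *)
Definition quad {R : realType} (a b c : R) (z : R * R) : R :=
  a * z.1 ^+ 2 + b * (z.1 * z.2) + c * z.2 ^+ 2.

(** The function is the evaluation of a polynomial, so [derivE] reduces the analytic derivative to
    the formal one. *)
Lemma derive1_quadratic {R : realType} (p q r x : R) :
  derive1 (fun t : R => p * t ^+ 2 + q * t + r) x = 2 * p * x + q.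
Proof.
pose f := p%:P * 'X^2 + q%:P * 'X + r%:P.
have -> : (fun t : R => p * t ^+ 2 + q * t + r) = horner f.
  by apply/funext => t; rewrite /f !hornerE.
rewrite -derivE /f !poly.derivE !hornerE; ring.
Qed.

Lemma gradient_quad {R : realType} (a b c : R) (z : R * R) :
  gradient (quad a b c) z = (2 * a * z.1 + b * z.2, b * z.1 + 2 * c * z.2).
Proof.
rewrite /gradient /quad /=; congr pair.
  rewrite -(@derive1_quadratic _ a (b * z.2) (c * z.2 ^+ 2) z.1).
  by congr derive1; apply/funext => t; ring.
rewrite [RHS]addrC -(@derive1_quadratic _ c (b * z.1) (a * z.1 ^+ 2) z.2).
by congr derive1; apply/funext => t; ring.
Qed.

Lemma octagonO_e1 (R : realType) : octagonO R (1, 0).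
Proof.
rewrite /octagonO /=; split; rewrite ?lexx ?ler01 //.
by rewrite addr0 -[leLHS]sqrtr1 ler_sqrt; lra.
Qed.

Lemma octagonO_e2 (R : realType) : octagonO R (0, 1).
Proof.
have [h1 h2 h3] := octagonO_e1 R; split => //=; rewrite addrC; exact: h3.
Qed.

(** This is the midpoint of the slanted edge: since 1/sqrt 2 = sqrt 2 / 2, the coordinates add up to
    exactly sqrt 2. *)
Lemma octagonO_diag (R : realType) :
  octagonO R ((Num.sqrt 2)^-1, (Num.sqrt 2)^-1).
Proof.
have s2 : Num.sqrt 2 ^+ 2 = 2 :> R by rewrite sqr_sqrtr; lra.
have s0 : 0 < Num.sqrt 2 :> R by rewrite sqrtr_gt0; lra.
have e : (Num.sqrt 2)^-1 = Num.sqrt 2 / 2 :> R.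
  apply: (mulfI (lt0r_neq0 s0)); rewrite divff ?lt0r_neq0 //.
  by rewrite mulrA -expr2 s2 divff // pnatr_eq0.
have s1 : Num.sqrt 2 <= 2 :> R by nra.
by rewrite /octagonO /= e; split; try (apply/andP; split); lra.
Qed.

Lemma le_normO {R : realType} (a b c : R) {z : R * R} :
  octagonO R z -> `|quad a b c z| <= normO (quad a b c).
Proof.
move=> Oz; apply: ub_le_sup; last by exists z.
(* Each monomial lies in [0, 1] on the unit square, so this bounds the set and [normO] is a genuine
   supremum. *)
exists (`|a| + `|b| + `|c|) => _ [[x y] [/= /andP[x0 x1] /andP[y0 y1] _] <-].
rewrite /quad /=; apply: le_trans (ler_normD _ _) _; apply: lerD.
  apply: le_trans (ler_normD _ _) _; apply: lerD.
    by rewrite normrM ler_piMr // ger0_norm ?exprn_ge0 // exprn_ile1.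
  by rewrite normrM ler_piMr // ger0_norm ?mulr_ge0 // mulr_ile1.
by rewrite normrM ler_piMr // ger0_norm ?exprn_ge0 // exprn_ile1.
Qed.

Lemma normO_ge0 {R : realType} (a b c : R) : 0 <= normO (quad a b c).
Proof. exact: le_trans (normr_ge0 _) (le_normO _ _ _ (octagonO_e1 R)). Qed.

Lemma coef_normO {R : realType} (a b c : R) (N := normO (quad a b c)) :
  [/\ `|a| <= N, `|c| <= N & `|a + b + c| <= 2 * N].
Proof.
have h1 := le_normO a b c (octagonO_e1 R).
have h2 := le_normO a b c (octagonO_e2 R).
have h3 := le_normO a b c (octagonO_diag R).
move: h1 h2 h3; rewrite -/N /quad /= !(expr0n, expr1n, mulr1, mulr0, mul0r).
rewrite !(addr0, add0r) => h1 h2; rewrite -expr2 exprVn sqr_sqrtr; last lra.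
by rewrite -!mulrDl normrM [`|2^-1|]ger0_norm; [split=> //; lra | lra].
Qed.

Lemma unit_square_gradient_le (R : realDomainType) (a b c N x y : R) :
  `|a| <= N -> `|c| <= N -> `|a + b + c| <= 2 * N ->
  0 <= x <= 1 -> 0 <= y <= 1 ->
  (2 * a * x + b * y) ^+ 2 + (b * x + 2 * c * y) ^+ 2 <= 20 * N ^+ 2.
Proof.
rewrite !ler_norml => /andP[a1 a2] /andP[c1 c2] /andP[s1 s2].
move=> /andP[x0 x1] /andP[y0 y1].
set F10 := 4 * a ^+ 2 + b ^+ 2; set F01 := b ^+ 2 + 4 * c ^+ 2.
set F11 := 2 * (a + b + c) ^+ 2 + 2 * (a - c) ^+ 2.
have -> : (2 * a * x + b * y) ^+ 2 + (b * x + 2 * c * y) ^+ 2 =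
    F10 * (x * (x - y)) + F01 * (y * (y - x)) + F11 * (x * y).
  by rewrite /F10 /F01 /F11; ring.
have N0 : 0 <= N by lra.
have sqle (u M : R) : - M <= u -> u <= M -> u ^+ 2 <= M ^+ 2 by nra.
have a' := sqle _ _ a1 a2; have c' := sqle _ _ c1 c2.
(* Here b = (a + b + c) - a - c, of size at most 2N + N + N. *)
have b' : b ^+ 2 <= (4 * N) ^+ 2 by apply: sqle; lra.
have s' := sqle _ _ s1 s2.
have d' : (a - c) ^+ 2 <= (2 * N) ^+ 2 by apply: sqle; lra.
have h10 : F10 <= 20 * N ^+ 2 by rewrite /F10; nra.
have h01 : F01 <= 20 * N ^+ 2 by rewrite /F01; nra.
have h11 : F11 <= 20 * N ^+ 2 by rewrite /F11; nra.
have p10 : 0 <= F10 by rewrite /F10; nra.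
have p01 : 0 <= F01 by rewrite /F01; nra.
have K0 : 0 <= 20 * N ^+ 2 by nra.
(* From here on the three values and their common bound are opaque, which keeps the degree low for
   [nra]. *)
move: F10 F01 F11 (20 * N ^+ 2) h10 h01 h11 p10 p01 K0 {a' b' c' s' d'}.
move=> A B D K AK BK DK A0 B0 K0.
have xy0 : 0 <= x * y by exact: mulr_ge0.
have Dxy : D * (x * y) <= K * (x * y) by exact: ler_wpM2r.
have xx1 : x ^+ 2 <= 1 by nra.
have yy1 : y ^+ 2 <= 1 by nra.
(* If x <= y, the term A x (x - y) is nonpositive and is dropped; the other two are at most K (y (y
   - x) + x y) = K y^2 <= K. The case y <= x is symmetric. *)
have [xy | /ltW xy] := lerP x y.
  have h1 : 0 <= A * (x * (y - x)) by rewrite !mulr_ge0 // subr_ge0.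
  have h2 : B * (y * (y - x)) <= K * (y * (y - x)).
    by rewrite ler_wpM2r // mulr_ge0 // subr_ge0.
  have h3 : K * y ^+ 2 <= K by rewrite ler_piMr.
  nra.
have h1 : 0 <= B * (y * (x - y)) by rewrite !mulr_ge0 // subr_ge0.
have h2 : A * (x * (x - y)) <= K * (x * (x - y)).
  by rewrite ler_wpM2r // mulr_ge0 // subr_ge0.
have h3 : K * x ^+ 2 <= K by rewrite ler_piMr.
nra.
Qed.

(** With the constant under the root, the gradient bound becomes a comparison of radicands. *)
Lemma two_sqrt5M {R : realType} (N : R) :
  0 <= N -> 2 * Num.sqrt 5 * N = Num.sqrt (20 * N ^+ 2).
Proof.
move=> N0; have -> : 20 * N ^+ 2 = 5 * (2 * N) ^+ 2 by ring.
by rewrite sqrtrM ?sqrtr_sqr ?ger0_norm; [ring | lra | lra].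
Qed.

Lemma norm2_gradient_le {R : realType} (a b c : R) {z : R * R} :
  octagonO R z ->
  norm2 (gradient (quad a b c) z) <= 2 * Num.sqrt 5 * normO (quad a b c).
Proof.
move=> [z1 z2 _]; have [ha hc hs] := coef_normO a b c.
rewrite gradient_quad /norm2 two_sqrt5M ?normO_ge0 // ler_wsqrtr //=.
exact: unit_square_gradient_le.
Qed.

Lemma quadratic_formsP (R : realType) (P : R * R -> R) :
  quadratic_forms R P -> exists a b c, P = quad a b c.
Proof. by []. Qed.

Lemma quadratic_forms_quad {R : realType} (a b c : R) :
  quadratic_forms R (quad a b c).
Proof. by exists a, b, c. Qed.

(** A closed half-plane cuts a product of two segments. Together with the continuity below, this
    makes the maximum of the gradient norm attained. *)
Lemma compact_octagonO (R : realType) : compact (octagonO R).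
Proof.
have -> : octagonO R = (`[0, 1] `*` `[0, 1]) `&`
    (fun z : R * R => z.1 + z.2) @^-1` [set u | u <= Num.sqrt 2].
  apply/seteqP; split => [z [z1 z2 z3]|z [[z1 z2] z3]].
    by split => //; split; rewrite /= in_itv.
  by move: z1 z2 z3; rewrite /= !in_itv /=.
apply: compact_closedI; first by apply: compact_setX; exact: segment_compact.
apply: closed_comp; last exact: closed_le.
by move=> z _; apply: cvgD; [exact: cvg_fst | exact: cvg_snd].
Qed.

Lemma continuous_norm2_gradient {R : realType} (a b c : R) :
  continuous (fun z : R * R => norm2 (gradient (quad a b c) z)).
Proof.
move=> z; under eq_fun do rewrite gradient_quad.
apply: (@continuous_comp _ _ _ (fun z : R * R =>
  (2 * a * z.1 + b * z.2) ^+ 2 + (b * z.1 + 2 * c * z.2) ^+ 2) Num.sqrt);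
  last exact: sqrt_continuous.
have lin (p q : R) :
    {for z, continuous (fun z : R * R => (p * z.1 + q * z.2) ^+ 2)}.
  apply: (@continuous_comp _ _ _ (fun z : R * R => p * z.1 + q * z.2)
    (fun t => t ^+ 2)); last exact: exprn_continuous.
  by apply: cvgD; apply: cvgMr; [exact: cvg_fst | exact: cvg_snd].
by apply: cvgD; exact: lin.
Qed.

Lemma PstarE (R : realType) : @Pstar R = quad (-1) 4 (-1).
Proof. by apply/funext => z; rewrite /Pstar /quad; ring. Qed.

Lemma oppPstarE (R : realType) :
  (fun z => - Pstar z) = quad 1 (-4) 1 :> (R * R -> R).
Proof. by apply/funext => z; rewrite /Pstar /quad; ring. Qed.

Lemma normO_Pstar (R : realType) : normO (@Pstar R) = 1.
Proof.
apply/eqP; rewrite eq_le; apply/andP; split; last first.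
  (* The bound on the leading coefficient -1 already gives 1 <= [normO Pstar]. *)
  by have [] := @coef_normO R (-1) 4 (-1); rewrite -PstarE normrN1.
apply: ge_sup.
  by exists `|Pstar ((1, 0) : R * R)|, (1, 0) => //; exact: octagonO_e1.
move=> _ [[x y] [/= /andP[x0 x1] /andP[y0 y1] xy] <-].
have s0 : 0 <= Num.sqrt 2 :> R by exact: sqrtr_ge0.
have s2 : Num.sqrt 2 ^+ 2 = 2 :> R by rewrite sqr_sqrtr; lra.
have xy2 : (x + y) ^+ 2 <= 2 by rewrite -s2; nra.
have xy1 := sqr_ge0 (x - y).
(* The upper bound comes from Pstar = (x + y)^2 / 2 - 3 (x - y)^2 / 2 <= 1. *)
rewrite /Pstar /= ler_norml; apply/andP; split; last by nra.
(* For x <= y, 1 + Pstar = (1 - y^2) + (4 x y - x^2), and both summands are nonnegative; likewise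
   for y <= x. *)
by have [h | /ltW h] := lerP x y; nra.
Qed.

Lemma normO_oppPstar (R : realType) : normO (fun z : R * R => - Pstar z) = 1.
Proof.
rewrite -(normO_Pstar R) /normO; congr sup.
by apply: eq_imagel => z _; rewrite normrN.
Qed.

Theorem theorem4p1 (R : realType) :
  [/\ forall P : R * R -> R, quadratic_forms R P ->
        exists m : R,
          is_max [set norm2 (gradient P z) | z in octagonO R] m /\
          m <= 2 * Num.sqrt 5 * normO P,
      forall C : R,
        (forall P : R * R -> R, quadratic_forms R P ->
           forall z : R * R, octagonO R z ->
             norm2 (gradient P z) <= C * normO P) ->
        2 * Num.sqrt 5 <= C,
      is_markovO (2 * Num.sqrt 5 : R) &
      forall P : R * R -> R, P = @Pstar R \/ P = (fun z => - Pstar z) ->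
        [/\ quadratic_forms R P,
            octagonO R (1, 0), octagonO R (0, 1),
            norm2 (gradient P (1, 0)) = 2 * Num.sqrt 5 * normO P &
            norm2 (gradient P (0, 1)) = 2 * Num.sqrt 5 * normO P]].
Proof.
have qP : quadratic_forms R (@Pstar R) by rewrite PstarE; exact: quadratic_forms_quad.
have extremal (P : R * R -> R) : P = @Pstar R \/ P = (fun z => - Pstar z) ->
    [/\ quadratic_forms R P, octagonO R (1, 0), octagonO R (0, 1),
        norm2 (gradient P (1, 0)) = 2 * Num.sqrt 5 * normO P &
        norm2 (gradient P (0, 1)) = 2 * Num.sqrt 5 * normO P].
  move=> hP.
  (* Both signs are treated at once: P is e times [Pstar] with e^2 = 1, and its squared gradient at
     either point is 4 e^2 + 16 e^2 = 20. *)
  have [e ->] : (exists2 e : R, P = quad (- e) (4 * e) (- e) & e ^+ 2 = 1) /\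
      normO P = 1.
    case: hP => ->; [rewrite normO_Pstar | rewrite normO_oppPstar];
      split=> //; [exists 1 | exists (-1)]; rewrite ?oppPstarE ?PstarE;
      by [congr quad; ring | ring].
  case: e => e -> e2; split; [exact: quadratic_forms_quad | exact: octagonO_e1
    | exact: octagonO_e2 | |];
    rewrite gradient_quad two_sqrt5M // /norm2 /=; congr Num.sqrt; nra.
have [_ O10 _ P10 _] := extremal _ (or_introl erefl).
rewrite normO_Pstar mulr1 in P10.
have bernstein_ub z : octagonO R z -> ubound [set norm2 (gradient P z) | P in
    [set P | quadratic_forms R P /\ normO P <= 1]] (2 * Num.sqrt 5).
  move=> Oz _ [P [/quadratic_formsP[a [b [c ->]]] P1] <-].
  apply: le_trans (norm2_gradient_le a b c Oz) _.
  by rewrite ler_piMr // mulr_ge0 // sqrtr_ge0.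
(* [Pstar] is admissible at every z. This makes the set nonempty, as [ge_sup] requires, and gives
   the lower bound at (1, 0). *)
have bernstein_Pstar z : [set norm2 (gradient P z) | P in
    [set P | quadratic_forms R P /\ normO P <= 1]] (norm2 (gradient (@Pstar R) z)).
  by exists (@Pstar R) => //; split; rewrite ?normO_Pstar.
split => //.
- move=> _ /quadratic_formsP[a [b [c ->]]].
  have [z /set_mem Oz zmax] := compact_EVT_max
    (ex_intro _ _ O10) (@compact_octagonO R)
    (continuous_subspaceT (continuous_norm2_gradient a b c)).
  exists (norm2 (gradient (quad a b c) z)); split; last exact: norm2_gradient_le.
  by split=> [|_ [w Ow <-]]; [exists z | apply: zmax; exact: mem_set].
(* Optimality: the assumed inequality is tested on [Pstar] at (1, 0). *)
- by move=> C /(_ _ qP _ O10); rewrite P10 normO_Pstar mulr1.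
- split=> [|_ [z Oz <-]]; last first.
    by apply: ge_sup (bernstein_ub _ Oz); eexists; exact: bernstein_Pstar.
  (* The maximum is attained at (1, 0), where [Pstar] makes the uniform upper bound sharp. *)
  exists (1, 0) => //; apply/eqP; rewrite eq_le; apply/andP; split.
    by apply: ge_sup (bernstein_ub _ O10); eexists; exact: bernstein_Pstar.
  rewrite -P10; apply: ub_le_sup.
    by eexists; exact: bernstein_ub.
  exact: bernstein_Pstar.
Qed.
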